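(* Let $n\geqslant 2$ be an integer, let $A$ and $B$ be two rings with $\mathrm{char}(B)>n$, and let $h:A\rightarrow B$ be an $n$-Jordan homomorphism. Suppose further that $A$ has a unit $e$. Then $h(e)$ is in the centralizer of $h(A)$ (that is, $h(e)h(x)=h(x)h(e)$ for all $x\in A$), and there exists a Jordan homomorphism $\tau:A\rightarrow B$ such that $h=h(e)\tau$, i.e. $h(x)=h(e)\tau(x)$ for all $x\in A$.
   Context: Rings are associative and are not assumed to be commutative or to have a unit unless stated. For an integer $n\geqslant 2$ and rings $A,B$, an additive map $h:A\rightarrow B$ is called an $n$-Jordan homomorphism if $h(x^{n})=h(x)^{n}$ for all $x\in A$. A Jordan homomorphism is a $2$-Jordan homomorphism, i.e. an additive map $\tau:A\rightarrow B$ with $\tau(x^2)=\tau(x)^2$ for all $x\in A$. A ring $B$ is said to be of characteristic greater than $n$, written $\mathrm{char}(B)>n$, if for all $x\in B$, $n!\,x=0$ implies $x=0$. *)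

(* Defs.v *)
From HB Require Import structures.
From mathcomp Require Import all_boot ssralg.

Set Implicit Arguments.
Unset Strict Implicit.
Unset Printing Implicit Defensive.

Import GRing.Theory.
Local Open Scope ring_scope.

(* The rings of ssralg all have a unit. A ring without a unit is a zmodType
   which is also a semigroup, with the product distributing over the sum. Its
   product is the one of magmaType, so it is written in group_scope (%g). *)
HB.mixin Record isDistributiveRng R of GRing.Zmodule R & Semigroup R := {
  rng_mulDl : left_distributive (@mul R) +%R;
  rng_mulDr : right_distributive (@mul R) +%R
}.

#[short(type="rngType")]
HB.structure Definition Rng :=
  {R of GRing.Zmodule R & Semigroup R & isDistributiveRng R}.

(* x * ... * x with n factors, for n > 0: without a unit there is no power of
   exponent 0, and the value 0 given to it is arbitrary. *)
Definition rng_exp (R : rngType) (x : R) (n : nat) : R := iterop n (@mul R) x 0.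

Definition is_unit_elt (R : rngType) (e : R) : Prop :=
  left_id e (@mul R) /\ right_id e (@mul R).

Definition char_gt (R : rngType) (n : nat) : Prop :=
  forall x : R, x *+ n`! = 0 -> x = 0.

Definition n_jordan (n : nat) (A B : rngType) (h : {additive A -> B}) : Prop :=
  forall x : A, h (rng_exp x n) = rng_exp (h x) n.

Definition jordan (A B : rngType) (tau : {additive A -> B}) : Prop :=
  n_jordan 2 tau.

(* Main.v *)
Require Import Defs.
From HB Require Import structures.
From mathcomp Require Import all_boot all_algebra.

Set Implicit Arguments.
Unset Strict Implicit.
Unset Printing Implicit Defensive.

(* Comparing the coefficients of k^i, i = 0, 1, 2, in the polynomial identity
   h((e + k x)^n) = (h(e) + k h(x))^n gives, with a = h(e) and y = h(x),
     a = a^n,   n y = \sum_j a^j y a^(n-1-j),   C(n,2) h(x^2) = c_2(a, y),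
   where c_2(a, y) is the sum of the words with two letters y and n-2 letters a.
   The commutator of a with the second identity telescopes to
   n [a, y] = [a^n, y] = [a, y], hence a y = y a; then y = a^(n-1) y and
   h(x^2) = a^(n-2) y^2, so that tau(x) = a^(n-2) h(x) is a Jordan
   homomorphism. *)

Section TorsionFree.
Import GRing.Theory.
Local Open Scope ring_scope.

Lemma torsion_free_dvd (V : zmodType) (N d : nat) :
    (forall x : V, x *+ N = 0 -> x = 0) -> (d %| N)%N ->
  forall x : V, x *+ d = 0 -> x = 0.
Proof.
by move=> hN /dvdnP[q Nq] x hx; apply: hN; rewrite Nq mulnC mulrnA hx mul0rn.
Qed.

(* The coefficients are killed by the determinant of the Vandermonde matrix of
   0, ..., n, whose factors j - i all divide n!. *)
Lemma poly_coef_eq0 (V : zmodType) (n : nat) (c : nat -> V) :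
    (forall x : V, x *+ n`! = 0 -> x = 0) ->
    (forall k, \sum_(i < n.+1) c i *+ (k ^ i)%N = 0) ->
  forall i, (i <= n)%N -> c i = 0.
Proof.
move=> tf hc i hi.
pose M : 'M[int]_n.+1 := Vandermonde n.+1 (\row_(k < n.+1) (k : nat)%:Z).
pose i' := Ordinal (hi : (i < n.+1)%N).
have: c i *~ \det M = 0.
  (* Cramer's rule: [M *m \adj M] is the scalar matrix of [\det M]. After the two sums are
     exchanged, column [k] of [M] contributes a multiple of the hypothesis at [k], which is 0. *)
  transitivity (\sum_(l < n.+1) c l *~ (M *m \adj M) l i').
    rewrite mul_mx_adj (bigD1 i') //= big1 ?addr0 ?mxE ?eqxx //.
    by move=> l /negPf nl; rewrite mxE nl.
  under eq_bigr => l _ do rewrite mxE mulrz_sumr.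
  rewrite exchange_big big1 //= => k _.
  under eq_bigr => l _ do rewrite mulrzA !mxE -!natz -natrX natz.
  by rewrite -mulrz_suml hc mul0rz.
rewrite det_Vandermonde.
pose regular (z : int) := forall x : V, x *~ z = 0 -> x = 0.
have regularM z t : regular z -> regular t -> regular (z * t).
  by move=> hz ht x; rewrite mulrzA => /ht/hz.
move: (c i); rewrite -/(regular _).
apply: (big_ind regular) => // k _; apply: (big_ind regular) => // l ltkl x.
rewrite !mxE subzn ?(ltnW ltkl) //; apply: torsion_free_dvd tf _ x.
by rewrite dvdn_fact // subn_gt0 ltkl (leq_trans (leq_subr _ _)) // -ltnS.
Qed.

End TorsionFree.

Section Rng.
Import GRing.Theory.
Local Open Scope ring_scope.
Local Notation "x * y" := ((x * y)%g) : ring_scope.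

Section Mul.
Variables (R : rngType) (a : R).

(** Iterating this map gives $x \mapsto a^m x$ even for $m = 0$, where [rng_exp a 0] is not a
    unit. *)
Definition rng_lmul (x : R) : R := a * x.
Definition rng_rmul (x : R) : R := x * a.

Fact rng_lmul_is_zmod_morphism : GRing.zmod_morphism rng_lmul.
Proof.
move=> x y; apply: (@addIr _ (a * y)).
by rewrite /rng_lmul -rng_mulDr !subrK.
Qed.

Fact rng_rmul_is_zmod_morphism : GRing.zmod_morphism rng_rmul.
Proof.
move=> x y; apply: (@addIr _ (y * a)).
by rewrite /rng_rmul -rng_mulDl !subrK.
Qed.

HB.instance Definition _ :=
  GRing.isZmodMorphism.Build R R rng_lmul rng_lmul_is_zmod_morphism.
HB.instance Definition _ :=
  GRing.isZmodMorphism.Build R R rng_rmul rng_rmul_is_zmod_morphism.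

(** Needed for the additivity of $\tau = a^{n-2} h$. *)
Fact iter_rng_lmul_is_zmod_morphism m : GRing.zmod_morphism (iter m rng_lmul).
Proof. by elim: m => // m IH x y; rewrite !iterS IH raddfB. Qed.

HB.instance Definition _ m := GRing.isZmodMorphism.Build R R
  (iter m rng_lmul) (iter_rng_lmul_is_zmod_morphism m).

End Mul.

Section Coef.
Variable R : rngType.
Implicit Types a x y : R.

Lemma rng_mulr0 a : a * 0 = 0. Proof. exact: (raddf0 (rng_lmul a)). Qed.
Lemma rng_mulBr a x y : a * (x - y) = a * x - a * y.
Proof. exact: (raddfB (rng_lmul a)). Qed.
Lemma rng_mulrnAr a x k : a * (x *+ k) = (a * x) *+ k.
Proof. exact: (raddfMn (rng_lmul a)). Qed.
Lemma rng_mulrnAl a x k : (x *+ k) * a = (x * a) *+ k.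
Proof. exact: (raddfMn (rng_rmul a)). Qed.
Lemma rng_mulr_sumr a n (F : 'I_n -> R) :
  a * (\sum_(i < n) F i) = \sum_(i < n) a * F i.
Proof. exact: (raddf_sum (rng_lmul a)). Qed.

Lemma rng_expS a m : rng_exp a m.+2 = a * rng_exp a m.+1. Proof. by []. Qed.

Lemma rng_expSr a m : rng_exp a m.+2 = rng_exp a m.+1 * a.
Proof. by elim: m => // m IH; rewrite rng_expS {1}IH mulgA. Qed.

(* The sum of the words with i letters y and m + 1 - i letters a. *)
Fixpoint word_sum a y (m i : nat) : R :=
  if m is p.+1 then
    a * word_sum a y p i + (if i is j.+1 then y * word_sum a y p j else 0)
  else if i is j.+1 then (if j is 0 then y else 0) else a.

Lemma word_sumS a y m i :
  word_sum a y m.+1 i.+1 = a * word_sum a y m i.+1 + y * word_sum a y m i.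
Proof. by []. Qed.

Lemma word_sum_eq0 a y m i : (m.+1 < i)%N -> word_sum a y m i = 0.
Proof.
elim: m i => [|m IH] [|[|i]] //= lti.
by rewrite !IH ?rng_mulr0 ?addr0 // ltnW.
Qed.

Lemma word_sum0 a y m : word_sum a y m 0 = rng_exp a m.+1.
Proof. by elim: m => //= m ->; rewrite addr0. Qed.

(** Noncommutative binomial expansion, by induction on the length, splitting the words according to
    their first letter. *)
Lemma rng_exp_addMn a y k m :
  rng_exp (a + y *+ k) m.+1 =
  \sum_(i < m.+2) word_sum a y m i *+ (k ^ i)%N.
Proof.
elim: m => [|m IH].
  by rewrite !big_ord_recl big_ord0 /= addr0 expn1.
rewrite rng_expS IH rng_mulDl !rng_mulr_sumr /=.
under [RHS]eq_bigr => i _ do rewrite mulrnDl.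
(* Words starting with [a] lose the top index, where [word_sum] vanishes; those starting with [y]
   lose index 0, and the shift absorbs the extra factor [k]. *)
rewrite big_split /= [X in _ = X + _]big_ord_recr /= word_sum_eq0 //.
rewrite rng_mulr0 mul0rn addr0; congr (_ + _); first last.
  rewrite [RHS]big_ord_recl /= mul0rn add0r; apply: eq_bigr => i _.
  by rewrite rng_mulrnAr rng_mulrnAl -mulrnA expnS mulnC.
by apply: eq_bigr => i _; rewrite rng_mulrnAr.
Qed.

Lemma word_sum1_comm a y m :
  a * word_sum a y m 1 - word_sum a y m 1 * a =
  rng_exp a m.+1 * y - y * rng_exp a m.+1.
Proof.
elim: m => //= m IH; rewrite word_sum0 rng_mulDr rng_mulDl -!mulgA.
rewrite -(rng_expSr a m) opprD addrACA -rng_mulBr IH rng_mulBr.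
by rewrite mulgA addrA subrK.
Qed.

Lemma iter_rng_lmul_comm a y x m :
  a * y = y * a -> y * iter m (rng_lmul a) x = iter m (rng_lmul a) (y * x).
Proof.
by move=> ay; elim: m => //= m <-; rewrite /rng_lmul !mulgA ay.
Qed.

Lemma iter_rng_lmulM a x y m :
  iter m (rng_lmul a) (x * y) = iter m (rng_lmul a) x * y.
Proof. by elim: m => //= m ->; rewrite /rng_lmul mulgA. Qed.

Lemma rng_exp_iter a m : rng_exp a m.+1 = iter m (rng_lmul a) a.
Proof. by elim: m => //= m <-. Qed.

Lemma comm_word_sum1 a y m : a * y = y * a ->
  word_sum a y m 1 = iter m (rng_lmul a) y *+ m.+1.
Proof.
move=> ay; elim: m => //= m ->; rewrite word_sum0 rng_exp_iter.
rewrite rng_mulrnAr (iter_rng_lmul_comm a m ay) -ay -[a * y]/(rng_lmul a y).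
by rewrite -iterSr iterS -mulrSr.
Qed.

Lemma comm_word_sum2 a y m : a * y = y * a ->
  word_sum a y m.+1 2 = iter m (rng_lmul a) (y * y) *+ 'C(m.+2, 2).
Proof.
move=> ay; elim: m => [|m IH]; first by rewrite /= rng_mulr0 add0r.
rewrite word_sumS IH comm_word_sum1 // !rng_mulrnAr.
rewrite (iter_rng_lmul_comm y m.+1 ay) -[a * iter m _ _]/(iter m.+1 (rng_lmul a) (y * y)).
(* Pascal's rule counts the words by their first letter. *)
by rewrite -mulrnDr (binS m.+2 1) bin1.
Qed.

End Coef.
End Rng.

Theorem theorem2p4 (n : nat) (hn : 2 <= n) (A B : rngType)
    (hchar : char_gt B n) (h : {additive A -> B}) (hh : n_jordan n h)
    (e : A) (he : is_unit_elt e) :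
  (forall x : A, (h e * h x)%g = (h x * h e)%g) /\
  (exists tau : {additive A -> B},
     jordan tau /\ forall x : A, h x = (h e * tau x)%g).
Proof.
(* From here $n = m + 2$: [word_sum _ _ m.+1] runs over words of length $n$, and [iter m] multiplies
   by $h(e)^{n-2}$. *)
case: n hn hchar hh => [|[|m]] // _ hchar hh; case: he => e1 e1r.
have iter_e k x : iter k (rng_lmul e) x = x.
  by elim: k => //= k ->; apply: e1.
have coefE x i : i <= m.+2 ->
    h (word_sum e x m.+1 i) = word_sum (h e) (h x) m.+1 i.
  move=> lei; apply/eqP; rewrite -GRing.subr_eq0; apply/eqP.
  pose c i := (h (word_sum e x m.+1 i) - word_sum (h e) (h x) m.+1 i)%R.
  apply: (@poly_coef_eq0 B m.+2 c) => // k.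
  under eq_bigr => l _ do rewrite GRing.mulrnBl.
  rewrite GRing.sumrB -rng_exp_addMn -GRing.raddfMn -GRing.raddfD -hh.
  rewrite rng_exp_addMn GRing.raddf_sum.
  apply/eqP; rewrite GRing.subr_eq0; apply/eqP/eq_bigr => l _.
  by rewrite GRing.raddfMn.
have ex x : (e * x = x * e)%g by rewrite e1 e1r.
have dvd_fact d : 0 < d <= m.+2 -> d %| m.+2`! by apply: dvdn_fact.
have coef1 x : word_sum (h e) (h x) m.+1 1 = (h x *+ m.+2)%R.
  by rewrite -coefE // comm_word_sum1 // iter_e GRing.raddfMn.
have comm x : (h e * h x)%g = (h x * h e)%g.
  have := word_sum1_comm (h e) (h x) m.+1.
  rewrite coef1 -(word_sum0 (h e) (h x)) -coefE // word_sum0.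
  rewrite rng_exp_iter iter_e rng_mulrnAr rng_mulrnAl -GRing.mulrnBl.
  (* From $n [a, y] = [a, y]$ follows $(n-1) [a, y] = 0$, and $n - 1$ divides $n!$. *)
  rewrite GRing.mulrSr => /(canRL (GRing.addrK _)); rewrite GRing.subrr.
  move/(torsion_free_dvd hchar (dvd_fact m.+1 (leqnSn _))).
  by move/eqP; rewrite GRing.subr_eq0 => /eqP.
have cancel d (x y : B) : d %| m.+2`! -> (x *+ d = y *+ d)%R -> x = y.
  move=> dvd_d /eqP; rewrite -GRing.subr_eq0 -GRing.mulrnBl => /eqP.
  move/(torsion_free_dvd hchar dvd_d)/eqP.
  by rewrite GRing.subr_eq0 => /eqP.
have hM x : h (x * x)%g = iter m (rng_lmul (h e)) (h x * h x)%g.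
  apply: (@cancel 'C(m.+2, 2)).
    by rewrite -(bin_fact (isT : 2 <= m.+2)) dvdn_mulr.
  rewrite -comm_word_sum2 // -coefE // comm_word_sum2 // iter_e.
  by rewrite GRing.raddfMn.
split=> //; exists (iter m (rng_lmul (h e)) \o h); split=> x /=.
  (* With $y = h(x)$: $\tau(x)^2 = a^m (y a^m y) = a^m (a^m y^2) = a^m h(x^2) = \tau(x^2)$. *)
  by rewrite /rng_exp /= -iter_rng_lmulM (iter_rng_lmul_comm _ _ (comm x)) hM.
(* The coefficient of $k$ gives $n y = n a^{n-1} y$, and $a^{n-1} y = a \tau(x)$. *)
apply: (@cancel m.+2); first by rewrite dvd_fact /=.
by rewrite -coef1 comm_word_sum1.
Qed.
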